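(* Let $(X,f)$ be the CCS dialgebra and $(X,g)$ the CCS coalgebra (see context), and let $\mathsf{F}(X)=X+(X\times X)$, $\mathsf{B}=\mathcal{P}$, $\mathsf{T}(X)=\mathcal{P}(L\times X)$, $\mathsf{Id}$ the identity functor. Let $E$ be the subcategory of epimorphisms of $\mathit{Dialg}(\mathsf{F},\mathsf{B})$ and $E'$ that of $\mathit{Dialg}(\mathsf{Id},\mathsf{T})$. Let $\mathcal{R}_{(X,f)}=(X,f)/E$ (the whole coslice), and let $\mathcal{R}_{(X,g)}$ be the full subcategory of $(X,g)/E'$ whose objects are those epimorphisms $h$ out of $(X,g)$ such that for all processes $x,x',y,y'$, $h(x)=h(x')$ and $h(y)=h(y')$ imply $h(x\parallel y)=h(x'\parallel y')$. Then: (1) $\mathcal{R}_{(X,g)}$ satisfies conditions (1) and (2) required of $\mathcal{R}$ in the context; (2) $\mathit{id}_{\mathsf{F}X}$ is an invariant for $(X,g)$ and $\mathcal{R}_{(X,g)}$ from $\overline{\mathsf{F}}$ to $\mathsf{F}\circ\overline{\mathsf{Id}}=\overline{\mathsf{F}}$; (3) $\delta$ is an invariant for $(X,g)$ and $\mathcal{R}_{(X,g)}$ from $\mathsf{F}\circ\overline{\mathsf{T}}$ to $\overline{\mathsf{B}}$; (4) $\lambda$ is an invariant for $(X,f)$ and $\mathcal{R}_{(X,f)}$ from $\overline{\mathsf{Id}}$ to $\mathsf{T}\circ\overline{\mathsf{F}}$; (5) $\mu$ is an invariant for $(X,f)$ and $\mathcal{R}_{(X,f)}$ from $\mathsf{T}\circ\overline{\mathsf{B}}$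 to $\overline{\mathsf{T}}$.
   Context: General notions. For functors $\mathsf{F},\mathsf{B}:\mathbf{Set}\to\mathbf{Set}$, an $(\mathsf{F},\mathsf{B})$-dialgebra is a pair $(X,f)$ with $f:\mathsf{F}X\to\mathsf{B}X$; a homomorphism $h:(X,f)\to(Y,g)$ is a function with $g\circ\mathsf{F}h=\mathsf{B}h\circ f$. A $\mathsf{T}$-coalgebra is an $(\mathsf{Id},\mathsf{T})$-dialgebra. For a dialgebra $(X,f)$ and a subcategory $E$ of epimorphisms of its category, $(X,f)/E$ is the coslice: objects are epimorphisms $h:(X,f)\to(Y,g)$, arrows $h\to h'$ are epimorphisms $k$ with $k\circ h=h'$. A category $\mathcal{R}_{(X,f)}$ is required to be a full subcategory of $(X,f)/E$ with (1) for every object $h$ of $(X,f)/E$ an object $h'$ of $\mathcal{R}_{(X,f)}$ and an arrow $h\to h'$, and (2) $\mathit{id}_{(X,f)}$ an object. For an object $h$, $\hat h:\mathit{id}\to h$ is the arrow given by $h$. For $\mathsf{H}:\mathbf{Set}\to\mathbf{Set}$, the lifting $\overline{\mathsf{H}}:\mathcal{R}_{(X,f)}\to\mathbf{Set}$ is $\overline{\mathsf{H}}(h:(X,f)\to(Y,g))=\mathsf{H}Y$, $\overline{\mathsf{H}}(k)=\mathsf{H}k$; a composite like $\mathsf{T}\circ\overline{\mathsf{F}}$ sends $h$ to $\mathsf{T}\mathsf{F}Y$. For functors $\Phi,\Psi:\mathcal{R}_{(X,f)}\to\mathbf{Set}$, a function $k:\Phi(\mathit{id})\to\Psi(\mathit{id})$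 is an invariant from $\Phi$ to $\Psi$ iff for all $x_1,x_2\in\Phi(\mathit{id})$ and every object $h$, $\Phi\hat h(x_1)=\Phi\hat h(x_2)$ implies $\Psi\hat h(k(x_1))=\Psi\hat h(k(x_2))$. Functors: $\mathsf{F}(X)=X+(X\times X)$, $\mathsf{F}h(x)=h(x)$, $\mathsf{F}h(x,y)=(h(x),h(y))$ (elements written without coproduct tags); $\mathsf{B}(X)=\mathcal{P}(X)$, $\mathsf{B}h(S)=h[S]$; $\mathsf{T}(X)=\mathcal{P}(L\times X)$, $\mathsf{T}h(S)=\{(l,h(x))\mid(l,x)\in S\}$. CCS. Let $\mathcal{C}$ be a countable set of channels. Prefixes: $\alpha::=\tau\mid a\mid\bar a$ ($a\in\mathcal{C}$); $L$ is the set of prefixes. Processes: $P::=\sum_{i\in I}\alpha_i.P_i\mid P_1\parallel P_2\mid(\nu a)P$ with $I$ finite, sums taken up to reordering of summands; $\mathbf{0}$ is the empty sum, $\alpha.P$ a one-summand sum, and $\alpha.P+Q$ denotes a sum having $\alpha.P$ as a summand. $X$ is the set of processes. Free names: $\mathit{fn}(\tau)=\emptyset$, $\mathit{fn}(a)=\mathit{fn}(\bar a)=\{a\}$, $\mathit{fn}(\sum\alpha_i.P_i)=\bigcup_i(\mathit{fn}(\alpha_i)\cup\mathit{fn}(P_i))$, $\mathit{fn}(P\parallel Q)=\mathit{fn}(P)\cup\mathit{fn}(Q)$, $\mathit{fn}((\nu a)P)=\mathit{fn}(P)\setminus\{a\}$. Structural congruence $\equiv$ is the least congruence containing $\alpha$-conversion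 of $a$ in $(\nu a)P$, the commutative monoid laws for $\parallel$ with unit $\mathbf{0}$, and $(\nu a)(P\parallel Q)\equiv((\nu a)P)\parallel Q$ if $a\notin\mathit{fn}(Q)$, $(\nu a)\mathbf{0}\equiv\mathbf{0}$, $(\nu a)(\nu b)P\equiv(\nu b)(\nu a)P$. The CCS LTS is the least relation $P\xrightarrow{\alpha}P'$ closed under: (pre) $\alpha.P+Q\xrightarrow{\alpha}P$; (res) if $a\notin\mathit{fn}(\alpha)$ and $P\xrightarrow{\alpha}P'$ then $(\nu a)P\xrightarrow{\alpha}(\nu a)P'$; (par) if $P\xrightarrow{\alpha}P'$ then $P\parallel Q\xrightarrow{\alpha}P'\parallel Q$; (syn) if $P\xrightarrow{\bar c}P'$ and $Q\xrightarrow{c}Q'$ then $P\parallel Q\xrightarrow{\tau}P'\parallel Q'$; (str) if $P\equiv Q$, $P'\equiv Q'$ and $P\xrightarrow{\alpha}P'$ then $Q\xrightarrow{\alpha}Q'$. The CCS coalgebra is $(X,g)$ with $g(x)=\{(\alpha,y)\mid x\xrightarrow{\alpha}y\}$. The CCS dialgebra is the $(\mathsf{F},\mathsf{B})$-dialgebra $(X,f)$ where $f$ is the least function (writing $P\to R$ for $R\in f(P)$ and $(P,Q)\to R$ for $R\in f(P,Q)$) closed under: (tau) $\tau.P+Q\to P$; (res) $P\to P'$ implies $(\nu a)P\to(\nu a)P'$; (par$_1$) $P\to P'$ implies $P\parallel Q\to P'\parallel Q$; (int) $(P,Q)\to R$ implies $P\parallel Q\to R$; (hid) $(P,Q)\to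 R$ and $a\notin\mathit{fn}(Q)$ imply $((\nu a)P,Q)\to(\nu a)R$; (par$_2$) $(P,Q)\to R$ implies $(P\parallel S,Q)\to S\parallel R$; (syn) $(\bar a.P+S,a.Q+T)\to P\parallel Q$; (sym) $(P,Q)\to R$ implies $(Q,P)\to R$; (str$_1$) $P\to R$, $P\equiv Q$, $R\equiv S$ imply $Q\to S$; (str$_2$) $(P,Q)\to R$, $P\equiv S$, $Q\equiv T$, $R\equiv U$ imply $(S,T)\to U$. The maps: $\delta:\mathsf{F}\mathsf{T}X\to\mathsf{B}X$ with $\delta(p)=\{x\mid(\tau,x)\in p\}$ for $p\in\mathsf{T}X$ and $\delta(p_1,p_2)=\{x\parallel y\mid\exists a\in\mathcal{C}.\,((a,x)\in p_1\wedge(\bar a,y)\in p_2)\vee((\bar a,x)\in p_1\wedge(a,y)\in p_2)\}$; $\lambda:X\to\mathsf{T}\mathsf{F}X$ with $\lambda(x)=\{(\tau,x)\}\cup\{(a,(x,\bar a.\mathbf{0}))\mid a\in\mathcal{C}\}\cup\{(\bar a,(x,a.\mathbf{0}))\mid a\in\mathcal{C}\}$; $\mu:\mathsf{T}\mathsf{B}X\to\mathsf{T}X$ with $\mu(q)=\{(l,x)\mid\exists q'.\,(l,q')\in q\wedge x\in q'\}$. *)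

(* Defs.v *)
(* Classical logic is used (only) to decide equality of channel
   names inside the name-swapping operation used for alpha-conversion. *)
From Stdlib Require Import List Permutation ClassicalEpsilon FunctionalExtensionality PropExtensionality.
Import ListNotations.

Set Implicit Arguments.

(* Set functors (object part, morphism part).  Powersets are modelled as
   predicates [A -> Prop]; equality of sets is Leibniz equality of
   predicates (extensional via the whitelisted axioms).                *)

Record SFun := {
  Fo : Type -> Type;
  Fm : forall A B : Type, (A -> B) -> Fo A -> Fo B;
  Fm_id : forall (A : Type) (x : Fo A), Fm (fun y : A => y) x = x
}.
Arguments Fm s {A B} _ _.

Definition IdF : SFun := {| Fo := fun A => A; Fm := fun A B h => h;
  Fm_id := fun A x => eq_refl |}.

Definition FF : SFun :=
  {| Fo := fun A => (A + A * A)%type;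
     Fm := fun A B h z => match z with
                          | inl x => inl (h x)
                          | inr (x, y) => inr (h x, h y)
                          end;
     Fm_id := fun A z => match z with inl _ => eq_refl | inr (_, _) => eq_refl end |}.

Lemma BF_id (A : Type) (S : A -> Prop) :
  (fun y => exists x, S x /\ x = y) = S.
Proof.
  apply functional_extensionality; intro y; apply propositional_extensionality.
  split; [intros [x [Hx <-]]; exact Hx | intro H; exists y; split; auto].
Qed.

Lemma TF_id (L A : Type) (S : L * A -> Prop) :
  (fun p => exists x, S (fst p, x) /\ x = snd p) = S.
Proof.
  apply functional_extensionality; intros [l y]; apply propositional_extensionality.
  simpl; split; [intros [x [Hx <-]]; exact Hx | intro H; exists y; split; auto].
Qed.

Definition BF : SFun :=
  {| Fo := fun A => A -> Prop;
     Fm := fun A B h S => fun y => exists x, S x /\ h x = y;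
     Fm_id := @BF_id |}.

Definition TF (L : Type) : SFun :=
  {| Fo := fun A => (L * A) -> Prop;
     Fm := fun A B h S => fun p => exists x, S (fst p, x) /\ h x = snd p;
     Fm_id := @TF_id L |}.

Lemma compF_id (G H : SFun) (A : Type) (x : Fo G (Fo H A)) :
  Fm G (Fm H (fun y : A => y)) x = x.
Proof.
  assert (E : Fm H (fun y : A => y) = fun y => y)
    by (apply functional_extensionality; intro; apply Fm_id).
  rewrite E; apply Fm_id.
Qed.

Definition compF (G H : SFun) : SFun :=
  {| Fo := fun A => Fo G (Fo H A);
     Fm := fun A B h => Fm G (Fm H h);
     Fm_id := @compF_id G H |}.

Record dialg (F B : SFun) := {
  car : Type;
  str : Fo F car -> Fo B car
}.
Arguments car {F B} _.
Arguments str {F B} _ _.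

Definition is_hom (F B : SFun) (D1 D2 : dialg F B) (h : car D1 -> car D2) : Prop :=
  forall x : Fo F (car D1), str D2 (Fm F h x) = Fm B h (str D1 x).

Definition is_epi (F B : SFun) (D1 D2 : dialg F B) (h : car D1 -> car D2) : Prop :=
  is_hom D1 D2 h /\
  forall (D3 : dialg F B) (a b : car D2 -> car D3),
    is_hom D2 D3 a -> is_hom D2 D3 b ->
    (forall x, a (h x) = b (h x)) -> forall y, a y = b y.

Record cosl_obj (F B : SFun) (D : dialg F B) := {
  cod : dialg F B;
  omap : car D -> car cod;
  omap_epi : is_epi D cod omap
}.
Arguments cod {F B D} _.
Arguments omap {F B D} _ _.

Definition cosl_arrow (F B : SFun) (D : dialg F B) (h h' : cosl_obj D)
    (k : car (cod h) -> car (cod h')) : Prop :=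
  is_epi (cod h) (cod h') k /\ forall x, k (omap h x) = omap h' x.

Lemma id_is_epi (F B : SFun) (D : dialg F B) : is_epi D D (fun x => x).
Proof.
  split.
  - intro x. rewrite !Fm_id. reflexivity.
  - intros D3 a b _ _ H y. exact (H y).
Qed.

Definition id_obj (F B : SFun) (D : dialg F B) : cosl_obj D :=
  {| cod := D; omap := fun x => x; omap_epi := id_is_epi D |}.

(* A full subcategory of D/E (given by a predicate on objects) satisfies
   conditions (1) and (2) of the context. *)
Definition R_conditions (F B : SFun) (D : dialg F B) (Rp : cosl_obj D -> Prop) : Prop :=
  (forall h : cosl_obj D, exists h' : cosl_obj D,
       Rp h' /\ exists k, cosl_arrow h h' k) /\
  Rp (id_obj D).

(* k is an invariant for D and R from the lifting of G to the lifting of H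
   (Phi(h : D -> (Y,_)) = G Y, Phi(k) = G k, and hat h is h itself). *)
Definition is_invariant (F B : SFun) (D : dialg F B) (Rp : cosl_obj D -> Prop)
    (G H : SFun) (k : Fo G (car D) -> Fo H (car D)) : Prop :=
  forall (x1 x2 : Fo G (car D)) (h : cosl_obj D), Rp h ->
    Fm G (omap h) x1 = Fm G (omap h) x2 ->
    Fm H (omap h) (k x1) = Fm H (omap h) (k x2).

Section CCS.
Variable C : Type.

Inductive prefix : Type :=
| tau : prefix
| inp : C -> prefix
| out : C -> prefix.

(* processes; a sum is a finite list of summands, considered up to
   reordering through structural congruence (rule sc_perm) *)
Inductive proc : Type :=
| Sum : list (prefix * proc) -> proc
| Par : proc -> proc -> proc
| Nu  : C -> proc -> proc.

Definition nil0 : proc := Sum [].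

Definition fn_pre (al : prefix) (c : C) : Prop :=
  match al with
  | tau => False
  | inp a => c = a
  | out a => c = a
  end.

Fixpoint fn (P : proc) (c : C) : Prop :=
  match P with
  | Sum l => (fix fnl (l : list (prefix * proc)) : Prop :=
                match l with
                | [] => False
                | (al, Q) :: l' => fn_pre al c \/ fn Q c \/ fnl l'
                end) l
  | Par P Q => fn P c \/ fn Q c
  | Nu a P => fn P c /\ c <> a
  end.

Definition swapn (a b c : C) : C :=
  if excluded_middle_informative (c = a) then b
  else if excluded_middle_informative (c = b) then a else c.

Definition swap_pre (a b : C) (al : prefix) : prefix :=
  match al with
  | tau => tau
  | inp c => inp (swapn a b c)
  | out c => out (swapn a b c)
  end.

Fixpoint swap (a b : C) (P : proc) : proc :=
  match P with
  | Sum l => Sum ((fix swl (l : list (prefix * proc)) :=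
                     match l with
                     | [] => []
                     | (al, Q) :: l' => (swap_pre a b al, swap a b Q) :: swl l'
                     end) l)
  | Par P Q => Par (swap a b P) (swap a b Q)
  | Nu c P => Nu (swapn a b c) (swap a b P)
  end.

Inductive sc : proc -> proc -> Prop :=
| sc_refl P : sc P P
| sc_sym P Q : sc P Q -> sc Q P
| sc_trans P Q R : sc P Q -> sc Q R -> sc P R
| sc_sum l1 l2 al P P' : sc P P' ->
    sc (Sum (l1 ++ (al, P) :: l2)) (Sum (l1 ++ (al, P') :: l2))
| sc_parl P P' Q : sc P P' -> sc (Par P Q) (Par P' Q)
| sc_parr P Q Q' : sc Q Q' -> sc (Par P Q) (Par P Q')
| sc_nu a P P' : sc P P' -> sc (Nu a P) (Nu a P')
| sc_perm l l' : Permutation l l' -> sc (Sum l) (Sum l')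
| sc_alpha a b P : ~ fn P b -> sc (Nu a P) (Nu b (swap a b P))
| sc_par_assoc P Q R : sc (Par P (Par Q R)) (Par (Par P Q) R)
| sc_par_comm P Q : sc (Par P Q) (Par Q P)
| sc_par_unit P : sc (Par P nil0) P
| sc_nu_par a P Q : ~ fn Q a -> sc (Nu a (Par P Q)) (Par (Nu a P) Q)
| sc_nu_nil a : sc (Nu a nil0) nil0
| sc_nu_nu a b P : sc (Nu a (Nu b P)) (Nu b (Nu a P)).

Inductive step : proc -> prefix -> proc -> Prop :=
| st_pre l al P : In (al, P) l -> step (Sum l) al P
| st_res a al P P' : ~ fn_pre al a -> step P al P' -> step (Nu a P) al (Nu a P')
| st_par P Q al P' : step P al P' -> step (Par P Q) al (Par P' Q)
| st_syn c P P' Q Q' : step P (out c) P' -> step Q (inp c) Q' ->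
    step (Par P Q) tau (Par P' Q')
| st_str P Q P' Q' al : sc P Q -> sc P' Q' -> step P al P' -> step Q al Q'.

Definition ccs_coalg : dialg IdF (TF prefix) :=
  {| car := proc; str := (fun (x : proc) (p : prefix * proc) => step x (fst p) (snd p)) : Fo IdF proc -> Fo (TF prefix) proc |}.

(* the CCS dialgebra relations: f1 P R  is  P -> R ;  f2 P Q R  is (P,Q) -> R *)
Inductive f1 : proc -> proc -> Prop :=
| f_tau l P : In (tau, P) l -> f1 (Sum l) P
| f_res a P P' : f1 P P' -> f1 (Nu a P) (Nu a P')
| f_par1 P P' Q : f1 P P' -> f1 (Par P Q) (Par P' Q)
| f_int P Q R : f2 P Q R -> f1 (Par P Q) R
| f_str1 P Q R S : f1 P R -> sc P Q -> sc R S -> f1 Q S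
with f2 : proc -> proc -> proc -> Prop :=
| f_hid a P Q R : f2 P Q R -> ~ fn Q a -> f2 (Nu a P) Q (Nu a R)
| f_par2 P Q R S : f2 P Q R -> f2 (Par P S) Q (Par S R)
| f_syn a P Q l1 l2 : In (out a, P) l1 -> In (inp a, Q) l2 ->
    f2 (Sum l1) (Sum l2) (Par P Q)
| f_sym P Q R : f2 P Q R -> f2 Q P R
| f_str2 P Q R S T U : f2 P Q R -> sc P S -> sc Q T -> sc R U -> f2 S T U.

Definition ccs_f (z : proc + proc * proc) : proc -> Prop :=
  match z with
  | inl P => f1 P
  | inr (P, Q) => f2 P Q
  end.

Definition ccs_dialg : dialg FF BF := {| car := proc; str := (ccs_f : Fo FF proc -> Fo BF proc) |}.

Definition delta (z : Fo (compF FF (TF prefix)) proc) : Fo BF proc :=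
  match z with
  | inl p => fun x => p (tau, x)
  | inr (p1, p2) => fun z => exists x y a, z = Par x y /\
      ((p1 (inp a, x) /\ p2 (out a, y)) \/ (p1 (out a, x) /\ p2 (inp a, y)))
  end.

Definition lambda (x : Fo IdF proc) : Fo (compF (TF prefix) FF) proc :=
  fun p =>
    (fst p = tau /\ snd p = inl x) \/
    (exists a, fst p = inp a /\ snd p = inr (x, Sum [(out a, nil0)])) \/
    (exists a, fst p = out a /\ snd p = inr (x, Sum [(inp a, nil0)])).

Definition mu (q : Fo (compF (TF prefix) BF) proc) : Fo (TF prefix) proc :=
  fun p => exists q', q (fst p, q') /\ q' (snd p).

Definition R_f (h : cosl_obj ccs_dialg) : Prop := True.

Definition R_g (h : cosl_obj ccs_coalg) : Prop :=
  forall x x' y y' : proc, omap h x = omap h x' -> omap h y = omap h y' ->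
    omap h (Par x y) = omap h (Par x' y').

End CCS.

Arguments nil0 {C}.
Arguments R_conditions {F B} D Rp.
Arguments is_invariant {F B} D Rp G H k.
Arguments R_g {C} h.
Arguments R_f {C} h.
Arguments delta {C} z _.
Arguments lambda {C} x p.
Arguments mu {C} q p.

(* Main.v *)
Require Import Defs.
From Stdlib Require Import List Permutation ClassicalEpsilon FunctionalExtensionality PropExtensionality ProofIrrelevance.
Import ListNotations.

(* Parts (2), (4) and (5) hold for every map out of the processes: (2) is
   trivial, the image of [lambda x] under [h] only depends on [h x], and [mu]
   is (the component of) a natural transformation, so it commutes with every
   [h].  Part (3) holds for every map whose kernel is a congruence for [Par],
   which is exactly the defining property of R_(X,g).

   For a coalgebra of T = P(L x -) we show
   that epimorphisms are surjective and that kernels of homomorphisms are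
   bisimulations; hence every epimorphism out of (X,g) is followed by an
   arrow into the quotient of (X,g) by bisimilarity.  It remains to show that
   this quotient lies in R_(X,g), i.e. that CCS bisimilarity is a congruence
   for [Par].  Since the CCS transitions are closed under structural
   congruence they cannot be inverted directly; we introduce a
   syntax-directed transition relation, prove that structurally congruent
   processes have matching syntax-directed transitions (harmony), and derive
   an inversion principle for transitions of [Par P Q]. *)

Lemma TF_map_comp (L A B D : Type) (f : A -> B) (g : B -> D) (S : L * A -> Prop) :
  Fm (TF L) g (Fm (TF L) f S) = Fm (TF L) (fun x => g (f x)) S.
Proof.
  apply functional_extensionality; intros [l z]; apply propositional_extensionality; simpl.
  split; [intros (y & (x & Hx & <-) & <-) | intros (x & Hx & <-)]; eauto.
Qed.

Lemma TF_map_ext_on (L A B : Type) (f g : A -> B) (S : L * A -> Prop) :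
  (forall l x, S (l, x) -> f x = g x) -> Fm (TF L) f S = Fm (TF L) g S.
Proof.
  intro Hfg; apply functional_extensionality; intros [l z]; apply propositional_extensionality.
  simpl; split; intros (x & Hx & <-); exists x; split; eauto; symmetry; eauto.
Qed.

Lemma TF_map_transfer {L A B : Type} {h : A -> B} {p q : L * A -> Prop} {l v} :
  Fm (TF L) h p = Fm (TF L) h q -> p (l, v) -> exists v', q (l, v') /\ h v' = h v.
Proof.
  intros E Hp; assert (Hl : Fm (TF L) h p (l, h v)) by (simpl; eauto).
  rewrite E in Hl; exact Hl.
Qed.

(* The flattening T(P X) -> T X, taking the union of labelled target sets,
   is a natural transformation; [mu] is its component at processes. *)
Definition flatten_T {L A : Type} (q : L * (A -> Prop) -> Prop) : L * A -> Prop :=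
  fun p => exists q', q (fst p, q') /\ q' (snd p).

Lemma flatten_T_natural (L A B : Type) (h : A -> B) (q : L * (A -> Prop) -> Prop) :
  Fm (TF L) h (flatten_T q) = flatten_T (Fm (compF (TF L) BF) h q).
Proof.
  apply functional_extensionality; intros [l y]; apply propositional_extensionality; simpl.
  split.
  - intros (x & (q' & Hq & Hx) & <-); exists (Fm BF h q'); split; simpl; eauto.
  - intros (q'' & (q' & Hq & Eq) & Hy); simpl in *; subst q''.
    destruct Hy as (x & Hx & <-); exists x; split; [exists q'|]; auto.
Qed.

Lemma surj_hom_epi (F B : SFun) (D1 D2 : dialg F B) (h : car D1 -> car D2) :
  is_hom D1 D2 h -> (forall y, exists x, h x = y) -> is_epi D1 D2 h.
Proof. intros Hh Hs; split; [exact Hh|]; intros D3 a b _ _ Hab y; destruct (Hs y) as [x <-]; auto. Qed.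

Section TCoalgebra.
Variables (L : Type) (D : dialg IdF (TF L)).
Notation X := (car D).

Lemma hom_trans (D2 : dialg IdF (TF L)) (h : X -> car D2) x l z :
  is_hom D D2 h -> (str D2 (h x) (l, z) <-> exists x', str D x (l, x') /\ h x' = z).
Proof. intro Hh; pose proof (Hh x) as E; simpl in E; rewrite E; reflexivity. Qed.

(* Epimorphisms of T-coalgebras are surjective: the two maps tagging a state
   with [true], resp. with whether it lies in the image of [h], are both
   homomorphisms into a suitable coalgebra (the image is closed under
   transitions) and agree on the image, hence everywhere. *)
Lemma epi_surjective (D2 : dialg IdF (TF L)) (h : X -> car D2) :
  is_epi D D2 h -> forall y, exists x, h x = y.
Proof.
  intros [Hh Hepi] y.
  set (inIm := fun y => if excluded_middle_informative (exists x, h x = y) then true else false).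
  assert (inIm_spec : forall y, inIm y = true <-> exists x, h x = y).
  { intro y0; unfold inIm; destruct excluded_middle_informative; split; congruence || tauto. }
  set (tagT := fun z : car D2 => (z, true)); set (tagI := fun z : car D2 => (z, inIm z)).
  set (D3 := Build_dialg IdF (TF L) (car D2 * bool)
     ((fun w => Fm (TF L) (if snd w then tagT else tagI) (str D2 (fst w)))
       : Fo IdF (car D2 * bool) -> Fo (TF L) (car D2 * bool))).
  assert (HT : is_hom D2 D3 tagT) by (intro; reflexivity).
  assert (HI : is_hom D2 D3 tagI).
  { intro y0; simpl; destruct (inIm y0) eqn:Hy0; [|reflexivity].
    apply TF_map_ext_on; intros l z Hz; unfold tagT, tagI; f_equal; symmetry.
    apply inIm_spec in Hy0; destruct Hy0 as [x <-].
    apply (hom_trans D2 h x l z Hh) in Hz; destruct Hz as (x' & _ & Ex').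
    apply inIm_spec; eauto. }
  assert (Hagree : forall x, tagT (h x) = tagI (h x))
    by (intro x; unfold tagT, tagI; f_equal; symmetry; apply inIm_spec; eauto).
  pose proof (Hepi D3 tagT tagI HT HI Hagree y) as E; injection E as E.
  apply inIm_spec; congruence.
Qed.

Definition is_bisim (R : X -> X -> Prop) : Prop :=
  forall x y, R x y ->
    (forall l x', str D x (l, x') -> exists y', str D y (l, y') /\ R x' y') /\
    (forall l y', str D y (l, y') -> exists x', str D x (l, x') /\ R x' y').

Definition bisim (x y : X) : Prop := exists R, is_bisim R /\ R x y.

Lemma bisim_refl x : bisim x x.
Proof. exists eq; split; [intros ? ? <-; split; eauto | reflexivity]. Qed.

Lemma bisim_sym x y : bisim x y -> bisim y x.
Proof.
  intros (R & HR & H); exists (fun u v => R v u); split; [|exact H].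
  intros u v Huv; destruct (HR _ _ Huv); split; auto.
Qed.

Lemma bisim_trans x y z : bisim x y -> bisim y z -> bisim x z.
Proof.
  intros (R1 & HR1 & H1) (R2 & HR2 & H2).
  exists (fun u w => exists v, R1 u v /\ R2 v w); split; eauto.
  intros u w (v & Huv & Hvw); destruct (HR1 _ _ Huv) as [A1 A2], (HR2 _ _ Hvw) as [B1 B2]; split.
  - intros l u' Hs; destruct (A1 _ _ Hs) as (v' & Hv & ?); destruct (B1 _ _ Hv) as (w' & ? & ?); eauto.
  - intros l w' Hs; destruct (B2 _ _ Hs) as (v' & Hv & ?); destruct (A2 _ _ Hv) as (u' & ? & ?); eauto.
Qed.

Lemma bisim_is_bisim : is_bisim bisim.
Proof.
  intros x y (R & HR & H); destruct (HR _ _ H) as [H1 H2]; split.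
  - intros l x' Hs; destruct (H1 _ _ Hs) as (y' & ? & ?); exists y'; split; [|exists R]; auto.
  - intros l y' Hs; destruct (H2 _ _ Hs) as (x' & ? & ?); exists x'; split; [|exists R]; auto.
Qed.

Lemma hom_kernel_bisim (D2 : dialg IdF (TF L)) (h : X -> car D2) x x' :
  is_hom D D2 h -> h x = h x' -> bisim x x'.
Proof.
  intros Hh E; exists (fun u v => h u = h v); split; [|exact E].
  assert (K : forall u v, h u = h v ->
            forall l u', str D u (l, u') -> exists v', str D v (l, v') /\ h u' = h v').
  { intros u v Euv l u' Hs.
    assert (Hv : str D2 (h v) (l, h u')) by (rewrite <- Euv; apply (hom_trans _ _ _ _ _ Hh); eauto).
    apply (hom_trans _ _ _ _ _ Hh) in Hv; destruct Hv as (v' & ? & ?); eauto. }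
  intros u v Euv; split; [apply K; exact Euv|].
  intros l v' Hs; destruct (K v u (eq_sym Euv) l v' Hs) as (u' & ? & ?); eauto.
Qed.

Lemma bisim_class_eq x y : bisim x = bisim y <-> bisim x y.
Proof.
  split; [intros E; rewrite E; apply bisim_refl|].
  intro H; apply functional_extensionality; intro z; apply propositional_extensionality.
  split; intro H'; [eapply bisim_trans; [apply bisim_sym|]|eapply bisim_trans]; eauto.
Qed.

Definition bclass : Type := {c : X -> Prop | exists x, c = bisim x}.

Lemma bclass_ext (c d : bclass) : proj1_sig c = proj1_sig d -> c = d.
Proof. destruct c, d; simpl; intros ->; f_equal; apply proof_irrelevance. Qed.

Definition class_of (x : X) : bclass := exist _ (bisim x) (ex_intro _ x eq_refl).

Lemma class_of_eq x y : class_of x = class_of y <-> bisim x y.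
Proof.
  rewrite <- bisim_class_eq; split; [intro E; exact (f_equal (@proj1_sig _ _) E)|].
  intro E; apply bclass_ext; exact E.
Qed.

Lemma class_of_surj (c : bclass) : exists x, class_of x = c.
Proof. destruct c as [c [x E]]; exists x; apply bclass_ext; simpl; auto. Qed.

Definition quotient_str (c : bclass) : L * bclass -> Prop :=
  fun p => exists x y, proj1_sig c = bisim x /\ proj1_sig (snd p) = bisim y /\ str D x (fst p, y).

Definition quotient : dialg IdF (TF L) :=
  Build_dialg IdF (TF L) bclass (quotient_str : Fo IdF bclass -> Fo (TF L) bclass).

(* Since bisimilarity is a bisimulation, the quotient map is a homomorphism. *)
Lemma class_of_hom : is_hom D quotient class_of.
Proof.
  intro x; apply functional_extensionality; intros [l c]; apply propositional_extensionality.
  simpl; unfold quotient_str; simpl; split.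
  - intros (x0 & y0 & E1 & E2 & Hs); apply bisim_class_eq in E1.
    destruct (proj2 (bisim_is_bisim _ _ E1) _ _ Hs) as (y1 & Hy1 & Hb).
    exists y1; split; [exact Hy1|]; apply bclass_ext; simpl; rewrite E2.
    apply bisim_class_eq, Hb.
  - intros (y & Hs & <-); exists x, y; auto.
Qed.

Definition quotient_obj : cosl_obj D :=
  {| cod := quotient; omap := class_of : car D -> car quotient;
     omap_epi := surj_hom_epi _ _ _ _ _ class_of_hom class_of_surj |}.

(* Every epimorphism out of [D] is followed by an arrow of the coslice into
   the quotient by bisimilarity, sending [h x] to the class of [x]
   (well defined because the kernel of [h] is contained in bisimilarity). *)
Lemma arrow_to_quotient (h : cosl_obj D) : exists k, cosl_arrow h quotient_obj k.
Proof.
  destruct h as [D2 h Hepi]; simpl.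
  pose proof (epi_surjective _ _ Hepi) as Hsurj.
  set (pre := fun y => proj1_sig (constructive_indefinite_description _ (Hsurj y))).
  assert (Hpre : forall y, h (pre y) = y)
    by (intro y; exact (proj2_sig (constructive_indefinite_description _ (Hsurj y)))).
  set (k := fun y => class_of (pre y)).
  assert (Hk : forall x, k (h x) = class_of x)
    by (intro x; apply class_of_eq, (hom_kernel_bisim _ _ _ _ (proj1 Hepi)), Hpre).
  exists k; split; [|exact Hk].
  apply surj_hom_epi.
  - intro y; destruct (Hsurj y) as [x0 <-].
    change (str quotient (k (h x0)) = Fm (TF L) k (str D2 (h x0))).
    pose proof (proj1 Hepi x0) as E.
    change (str D2 (h x0) = Fm (TF L) h (str D x0)) in E; rewrite Hk, E, TF_map_comp.
    transitivity (Fm (TF L) class_of (str D x0)); [exact (class_of_hom x0)|].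
    apply TF_map_ext_on; intros; symmetry; apply Hk.
  - intro c; destruct (class_of_surj c) as [x <-]; exists (h x); apply Hk.
Qed.

End TCoalgebra.

Section CCSTheory.
Variable C : Type.
Notation proc := (proc C).
Notation prefix := (prefix C).
Implicit Types (a b c d : C) (al : prefix) (P Q R : proc) (l : list (prefix * proc)).

(* Induction on processes, with the hypothesis available for every summand
   of a guarded sum (the type of processes is a nested inductive). *)
Section ProcInd.
Variable Pr : proc -> Prop.
Hypothesis HSum : forall l, Forall (fun p => Pr (snd p)) l -> Pr (Sum l).
Hypothesis HPar : forall P Q, Pr P -> Pr Q -> Pr (Par P Q).
Hypothesis HNu : forall a P, Pr P -> Pr (Nu a P).

Fixpoint proc_nested_ind (P : proc) : Pr P :=
  match P with
  | Sum l => HSum l ((fix go (l : list (prefix * proc)) : Forall (fun p => Pr (snd p)) l :=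
       match l with
       | [] => Forall_nil _
       | p :: l' => Forall_cons p (let (_, Q) as p return Pr (snd p) := p in proc_nested_ind Q) (go l')
       end) l)
  | Par P Q => HPar P Q (proc_nested_ind P) (proc_nested_ind Q)
  | Nu a P => HNu a P (proc_nested_ind P)
  end.
End ProcInd.

Lemma swapn_inv a b c : swapn a b (swapn a b c) = c.
Proof. unfold swapn; repeat (destruct excluded_middle_informative; subst; try congruence). Qed.

Lemma swapn_l a b : swapn a b a = b.
Proof. unfold swapn; destruct excluded_middle_informative; congruence. Qed.

Lemma swapn_other a b c : c <> a -> c <> b -> swapn a b c = c.
Proof. unfold swapn; repeat (destruct excluded_middle_informative; subst; try congruence). Qed.

Lemma swap_pre_inv a b al : swap_pre a b (swap_pre a b al) = al.
Proof. destruct al; simpl; rewrite ?swapn_inv; reflexivity. Qed.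

Lemma swap_pre_fresh a b al : ~ fn_pre al a -> ~ fn_pre al b -> swap_pre a b al = al.
Proof. destruct al; simpl; intros; f_equal; auto using swapn_other. Qed.

Lemma fn_pre_swap a b al c : fn_pre (swap_pre a b al) (swapn a b c) <-> fn_pre al c.
Proof.
  destruct al as [|e|e]; simpl; try tauto;
    split; intro H; subst; auto; rewrite <- (swapn_inv a b c), H, swapn_inv; reflexivity.
Qed.

Lemma fn_Sum l c :
  fn (Sum l) c <-> exists al Q, In (al, Q) l /\ (fn_pre al c \/ fn Q c).
Proof.
  induction l as [|[al Q] l IH]; simpl.
  - split; [tauto | intros (? & ? & [] & _)].
  - rewrite IH; split.
    + intros [H|[H|(al' & Q' & Hin & H)]]; eauto 6.
    + intros (al' & Q' & [E|Hin] & H); [injection E as <- <-; tauto | eauto 7].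
Qed.

Lemma swap_Sum a b l :
  swap a b (Sum l) = Sum (map (fun p => (swap_pre a b (fst p), swap a b (snd p))) l).
Proof.
  induction l as [|[al Q] l IH]; simpl; [reflexivity|].
  simpl in IH; injection IH as ->; reflexivity.
Qed.

Lemma swap_inv a b P : swap a b (swap a b P) = P.
Proof.
  induction P as [l Hl| |] using proc_nested_ind.
  - rewrite !swap_Sum, map_map; f_equal.
    induction Hl as [|[al Q] l HQ _ IHl]; simpl in *; [reflexivity|].
    rewrite swap_pre_inv, HQ, IHl; reflexivity.
  - simpl; rewrite IHP1, IHP2; reflexivity.
  - simpl; rewrite swapn_inv, IHP; reflexivity.
Qed.

Lemma fn_swap a b P c : fn (swap a b P) c <-> fn P (swapn a b c).
Proof.
  revert c; induction P as [l Hl| |] using proc_nested_ind; intro c.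
  - rewrite swap_Sum, !fn_Sum, Forall_forall in *; split.
    + intros (al & Q & Hin & Hf); apply in_map_iff in Hin.
      destruct Hin as ([al0 Q0] & E & Hin); injection E as <- <-.
      exists al0, Q0; split; [exact Hin|].
      destruct Hf as [Hf|Hf]; [left | right; apply (Hl _ Hin); exact Hf].
      rewrite <- (swapn_inv a b c) in Hf; apply fn_pre_swap in Hf; exact Hf.
    + intros (al & Q & Hin & Hf); exists (swap_pre a b al), (swap a b Q); split.
      * apply in_map_iff; exists (al, Q); auto.
      * destruct Hf as [Hf|Hf]; [left | right; apply (Hl _ Hin); exact Hf].
        rewrite <- (swapn_inv a b c); apply fn_pre_swap; exact Hf.
  - simpl; rewrite IHP1, IHP2; tauto.
  - simpl; rewrite IHP; split; intros [H1 H2]; split; auto; intro E; apply H2.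
    + subst; rewrite swapn_inv; reflexivity.
    + rewrite E, swapn_inv; reflexivity.
Qed.

(* Swapping is symmetric in the two names, so alpha-conversion can be read
   in both directions. *)
Lemma swapn_comm a b c : swapn b a c = swapn a b c.
Proof. unfold swapn; repeat (destruct excluded_middle_informative; subst; try congruence). Qed.

Lemma swap_comm a b P : swap b a P = swap a b P.
Proof.
  induction P as [l Hl| |] using proc_nested_ind.
  - rewrite !swap_Sum; f_equal; apply map_ext_in; intros [al Q] Hin.
    rewrite Forall_forall in Hl; specialize (Hl _ Hin); simpl in *.
    rewrite Hl; destruct al; simpl; rewrite ?(swapn_comm a b); reflexivity.
  - simpl; rewrite IHP1, IHP2; reflexivity.
  - simpl; rewrite (swapn_comm a b), IHP; reflexivity.
Qed.

(* A syntax-directed presentation of the CCS transitions: no structural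
   rule, but symmetric versions of the parallel and synchronisation rules.
   Its transitions can be analysed by inversion. *)
Inductive sstep : proc -> prefix -> proc -> Prop :=
| ss_pre l al P : In (al, P) l -> sstep (Sum l) al P
| ss_res a al P P' : ~ fn_pre al a -> sstep P al P' -> sstep (Nu a P) al (Nu a P')
| ss_parl P Q al P' : sstep P al P' -> sstep (Par P Q) al (Par P' Q)
| ss_parr P Q al Q' : sstep Q al Q' -> sstep (Par P Q) al (Par P Q')
| ss_synl c P P' Q Q' : sstep P (out c) P' -> sstep Q (inp c) Q' ->
    sstep (Par P Q) (tau C) (Par P' Q')
| ss_synr c P P' Q Q' : sstep P (inp c) P' -> sstep Q (out c) Q' ->
    sstep (Par P Q) (tau C) (Par P' Q').
Hint Constructors sstep : core.

Lemma sstep_fn_label P al P' c : sstep P al P' -> fn_pre al c -> fn P c.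
Proof.
  induction 1; intro Hc; simpl in *; try tauto.
  - apply fn_Sum; eauto.
  - split; auto; intros ->; contradiction.
Qed.

Lemma sstep_fn_target P al P' c : sstep P al P' -> fn P' c -> fn P c.
Proof. induction 1; intro Hc; simpl in *; try tauto; apply fn_Sum; eauto. Qed.

Lemma sstep_swap a b P al P' :
  sstep P al P' -> sstep (swap a b P) (swap_pre a b al) (swap a b P').
Proof.
  induction 1; try (simpl in *; eauto; fail).
  - rewrite swap_Sum; constructor; apply in_map_iff; exists (al, P); auto.
  - simpl; constructor; [rewrite fn_pre_swap|]; auto.
Qed.

Lemma nil_sstep al P : ~ sstep nil0 al P.
Proof. inversion 1 as [l al0 P0 Hin| | | | |]; destruct Hin. Qed.

Lemma sstep_step P al P' : sstep P al P' -> step P al P'.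
Proof.
  induction 1; try (constructor; assumption).
  - apply st_str with (Par Q P) (Par Q' P); try apply sc_par_comm; constructor; auto.
  - eapply st_syn; eauto.
  - apply st_str with (Par Q P) (Par Q' P'); try apply sc_par_comm; eapply st_syn; eauto.
Qed.

Definition sc_bisim P Q : Prop :=
  (forall al P', sstep P al P' -> exists Q', sstep Q al Q' /\ sc P' Q') /\
  (forall al Q', sstep Q al Q' -> exists P', sstep P al P' /\ sc P' Q').

Lemma sc_bisim_refl P : sc_bisim P P.
Proof. split; intros al X Hs; exists X; split; auto using sc_refl. Qed.

Lemma sc_bisim_sym P Q : sc_bisim P Q -> sc_bisim Q P.
Proof.
  intros [H1 H2]; split.
  - intros al Q' Hs; destruct (H2 _ _ Hs) as (P' & ? & ?); eauto using sc_sym.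
  - intros al P' Hs; destruct (H1 _ _ Hs) as (Q' & ? & ?); eauto using sc_sym.
Qed.

Lemma sc_bisim_trans P Q R : sc_bisim P Q -> sc_bisim Q R -> sc_bisim P R.
Proof.
  intros [H1 H2] [H3 H4]; split.
  - intros al P' Hs; destruct (H1 _ _ Hs) as (Q' & Hq & ?).
    destruct (H3 _ _ Hq) as (R' & ? & ?); eauto using sc_trans.
  - intros al R' Hs; destruct (H4 _ _ Hs) as (Q' & Hq & ?).
    destruct (H2 _ _ Hq) as (P' & ? & ?); eauto using sc_trans.
Qed.

Lemma sum_summand_sc l1 l2 al {P P' al0 X} :
  sc P P' -> In (al0, X) (l1 ++ (al, P) :: l2) ->
  exists X', In (al0, X') (l1 ++ (al, P') :: l2) /\ sc X X'.
Proof.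
  intros HP Hin; apply in_app_or in Hin; destruct Hin as [Hin|[E|Hin]].
  - exists X; split; [apply in_or_app|apply sc_refl]; auto.
  - injection E as <- <-; exists P'; split; [apply in_or_app; simpl|]; auto.
  - exists X; split; [apply in_or_app; simpl|apply sc_refl]; auto.
Qed.

Lemma sc_bisim_sum l1 l2 al P P' :
  sc P P' -> sc_bisim (Sum (l1 ++ (al, P) :: l2)) (Sum (l1 ++ (al, P') :: l2)).
Proof.
  intro HP; split; intros al0 X Hs; inversion Hs as [l al1 X1 Hin| | | | |]; subst.
  - destruct (sum_summand_sc l1 l2 al HP Hin) as (X' & ? & ?); eauto.
  - destruct (sum_summand_sc l1 l2 al (sc_sym HP) Hin) as (X' & ? & ?); eauto using sc_sym.
Qed.

Lemma sc_bisim_perm l l' : Permutation l l' -> sc_bisim (Sum l) (Sum l').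
Proof.
  intro Hp; split; intros al X Hs; inversion Hs; subst; exists X; split; auto using sc_refl;
    constructor; eauto using Permutation_in, Permutation_sym.
Qed.

Lemma sc_bisim_parl P P' Q : sc P P' -> sc_bisim P P' -> sc_bisim (Par P Q) (Par P' Q).
Proof.
  intros HP [H1 H2]; split.
  - intros al X Hs; inversion Hs; subst;
      try (match goal with Hp : sstep P _ _ |- _ => destruct (H1 _ _ Hp) as (Y & ? & ?) end);
      eexists; (split; [| apply sc_parl; eassumption]); eauto.
  - intros al X Hs; inversion Hs; subst;
      try (match goal with Hp : sstep P' _ _ |- _ => destruct (H2 _ _ Hp) as (Y & ? & ?) end);
      eexists; (split; [| apply sc_parl; eassumption]); eauto.
Qed.

Lemma sc_bisim_nu a P P' : sc_bisim P P' -> sc_bisim (Nu a P) (Nu a P').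
Proof.
  intros [H1 H2]; split; intros al X Hs; inversion Hs as [|a0 al0 P0 P1 Ha Hp| | | |]; subst.
  - destruct (H1 _ _ Hp) as (Y & ? & ?); exists (Nu a Y); split; [|apply sc_nu]; auto.
  - destruct (H2 _ _ Hp) as (Y & ? & ?); exists (Nu a Y); split; [|apply sc_nu]; auto.
Qed.

Ltac invert_sstep :=
  repeat match goal with
  | H : sstep (Par _ _) _ _ |- _ => inversion H; subst; clear H
  | H : sstep (Nu _ _) _ _ |- _ => inversion H; subst; clear H
  end.

Lemma sc_bisim_comm P Q : sc_bisim (Par P Q) (Par Q P).
Proof. split; intros al X Hs; invert_sstep; eexists; (split; [|apply sc_par_comm]); eauto. Qed.

Lemma sc_bisim_parr P Q Q' : sc Q Q' -> sc_bisim Q Q' -> sc_bisim (Par P Q) (Par P Q').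
Proof.
  intros HQ HQs; eapply sc_bisim_trans; [apply sc_bisim_comm|].
  eapply sc_bisim_trans; [apply sc_bisim_parl; eauto | apply sc_bisim_comm].
Qed.

Lemma sc_bisim_assoc P Q R : sc_bisim (Par P (Par Q R)) (Par (Par P Q) R).
Proof. split; intros al X Hs; invert_sstep; eexists; (split; [|apply sc_par_assoc]); eauto 7. Qed.

Lemma sc_bisim_unit P : sc_bisim (Par P nil0) P.
Proof.
  split; intros al X Hs; invert_sstep;
    try (exfalso; eapply nil_sstep; eassumption);
    eexists; (split; [|apply sc_par_unit]); eauto.
Qed.

Lemma sc_bisim_nu_nil a : sc_bisim (Nu a nil0) nil0.
Proof. split; intros al X Hs; invert_sstep; exfalso; eapply nil_sstep; eassumption. Qed.

Lemma sc_bisim_nu_nu a b P : sc_bisim (Nu a (Nu b P)) (Nu b (Nu a P)).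
Proof. split; intros al X Hs; invert_sstep; eexists; (split; [|apply sc_nu_nu]); eauto. Qed.

(* Scope extrusion: a name not free in [Q] cannot occur in the labels
   of [Q], so restriction commutes with the transitions of [Q]. *)
Lemma sc_bisim_nu_par a P Q : ~ fn Q a -> sc_bisim (Nu a (Par P Q)) (Par (Nu a P) Q).
Proof.
  intro HQ.
  assert (Hlab : forall al Q', sstep Q al Q' -> ~ fn_pre al a)
    by (intros al Q' Hs Hf; apply HQ; eapply sstep_fn_label; eauto).
  assert (Htgt : forall al Q', sstep Q al Q' -> ~ fn Q' a)
    by (intros al Q' Hs Hf; apply HQ; eapply sstep_fn_target; eauto).
  split; intros al X Hs; invert_sstep; eexists; (split; [|apply sc_nu_par]);
    first [ solve [eauto]
          | match goal with H : sstep Q _ _ |- _ =>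
              solve [eapply ss_synl; [apply ss_res; [exact (Hlab _ _ H)|]|]; eauto]
            || solve [eapply ss_synr; [apply ss_res; [exact (Hlab _ _ H)|]|]; eauto] end
          | solve [constructor; eauto; eapply Hlab; eauto] ].
Qed.

(* Alpha-conversion: a transition of [Nu a P] is matched by the renamed
   process, because the label avoids the fresh name [b]. *)
Lemma alpha_sstep a b P al X :
  ~ fn P b -> sstep (Nu a P) al X -> exists Y, sstep (Nu b (swap a b P)) al Y /\ sc X Y.
Proof.
  intros Hb Hs; inversion Hs as [|a0 al0 P0 P1 Ha Hp| | | |]; subst.
  assert (Hlb : ~ fn_pre al b) by (intro Hf; apply Hb; eapply sstep_fn_label; eauto).
  exists (Nu b (swap a b P1)); split.
  - constructor; [exact Hlb|].
    rewrite <- (swap_pre_fresh a b al Ha Hlb); apply sstep_swap; exact Hp.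
  - apply sc_alpha; intro Hf; apply Hb; eapply sstep_fn_target; eauto.
Qed.

Lemma sc_bisim_alpha a b P : ~ fn P b -> sc_bisim (Nu a P) (Nu b (swap a b P)).
Proof.
  intro Hb; split; [intros; eapply alpha_sstep; eauto|].
  intros al Y Hs.
  assert (Ha : ~ fn (swap a b P) a) by (rewrite fn_swap, swapn_l; exact Hb).
  destruct (alpha_sstep b a _ al Y Ha Hs) as (X & HX & Hsc).
  rewrite swap_comm, swap_inv in HX; exists X; split; [exact HX | apply sc_sym, Hsc].
Qed.

Lemma sc_sc_bisim {P Q} : sc P Q -> sc_bisim P Q.
Proof.
  induction 1; eauto using sc_bisim_refl, sc_bisim_sym, sc_bisim_trans, sc_bisim_sum,
    sc_bisim_parl, sc_bisim_parr, sc_bisim_nu, sc_bisim_perm, sc_bisim_alpha, sc_bisim_assoc,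
    sc_bisim_comm, sc_bisim_unit, sc_bisim_nu_par, sc_bisim_nu_nil, sc_bisim_nu_nu.
Qed.

Lemma step_sstep {P al P'} : step P al P' -> exists P'', sstep P al P'' /\ sc P'' P'.
Proof.
  induction 1 as [l al P Hin|a al P P' Ha _ (X & ? & ?)|P Q al P' _ (X & ? & ?)
                 |c P P' Q Q' _ (X & ? & ?) _ (Y & ? & ?)|P Q P' Q' al HPQ HP'Q' _ (X & HX & HXP')].
  - exists P; split; [constructor; auto | apply sc_refl].
  - exists (Nu a X); split; [|apply sc_nu]; auto.
  - exists (Par X Q); split; [|apply sc_parl]; auto.
  - exists (Par X Y); split; eauto.
    eapply sc_trans; [apply sc_parl | apply sc_parr]; eauto.
  - destruct (proj1 (sc_sc_bisim HPQ) _ _ HX) as (Y & HY & HXY).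
    exists Y; split; [exact HY|].
    eapply sc_trans; [apply sc_sym, HXY|]; eapply sc_trans; [exact HXP' | exact HP'Q'].
Qed.

Lemma st_parr P Q al Q' : step Q al Q' -> step (Par P Q) al (Par P Q').
Proof. intro H; apply st_str with (Par Q P) (Par Q' P); try apply sc_par_comm; constructor; auto. Qed.

Lemma st_synr c P P' Q Q' :
  step P (inp c) P' -> step Q (out c) Q' -> step (Par P Q) (tau C) (Par P' Q').
Proof. intros H1 H2; apply st_str with (Par Q P) (Par Q' P'); try apply sc_par_comm; eapply st_syn; eauto. Qed.

Lemma step_par_inv P Q al T : step (Par P Q) al T ->
  (exists P', step P al P' /\ sc (Par P' Q) T) \/
  (exists Q', step Q al Q' /\ sc (Par P Q') T) \/
  (exists c P' Q', al = tau C /\ sc (Par P' Q') T /\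
     ((step P (out c) P' /\ step Q (inp c) Q') \/ (step P (inp c) P' /\ step Q (out c) Q'))).
Proof.
  intro Hs; destruct (step_sstep Hs) as (T0 & H0 & Hsc); inversion H0; subst;
    [left | right; left | right; right | right; right]; eauto 10 using sstep_step.
Qed.

Notation ccs_bisim := (bisim _ (ccs_coalg C)).

Lemma ccs_bisim_match {P Q al P'} :
  ccs_bisim P Q -> step P al P' -> exists Q', step Q al Q' /\ ccs_bisim P' Q'.
Proof. intros HPQ Hs; exact (proj1 (bisim_is_bisim _ _ _ _ HPQ) al P' Hs). Qed.

(* Parallel compositions of bisimilar components, up to structural
   congruence; this relation is a bisimulation. *)
Definition par_closure (S S' : proc) : Prop :=
  exists P P' Q Q', ccs_bisim P P' /\ ccs_bisim Q Q' /\ sc S (Par P Q) /\ sc S' (Par P' Q').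

Lemma par_closure_sym {S S'} : par_closure S S' -> par_closure S' S.
Proof.
  intros (P & P' & Q & Q' & HP & HQ & H1 & H2); exists P', P, Q', Q.
  repeat split; auto using bisim_sym.
Qed.

Lemma par_closure_step {S S' al T} :
  par_closure S S' -> step S al T -> exists T', step S' al T' /\ par_closure T T'.
Proof.
  intros (P & P' & Q & Q' & HP & HQ & HS & HS') Hs.
  assert (Hlift : forall Z, step (Par P' Q') al Z -> step S' al Z)
    by (intros Z Hz; eapply st_str; [apply sc_sym, HS' | apply sc_refl | exact Hz]).
  apply (st_str HS (sc_refl T)), step_par_inv in Hs.
  destruct Hs as [(P0 & HP0 & Hsc)|[(Q0 & HQ0 & Hsc)|(c & P0 & Q0 & -> & Hsc & Hsyn)]].
  - destruct (ccs_bisim_match HP HP0) as (P1 & HP1 & Hb).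
    exists (Par P1 Q'); split; [apply Hlift; constructor; exact HP1|].
    exists P0, P1, Q, Q'; repeat split; auto using sc_sym, sc_refl.
  - destruct (ccs_bisim_match HQ HQ0) as (Q1 & HQ1 & Hb).
    exists (Par P' Q1); split; [apply Hlift, st_parr, HQ1|].
    exists P, P', Q0, Q1; repeat split; auto using sc_sym, sc_refl.
  - destruct Hsyn as [[HP0 HQ0]|[HP0 HQ0]];
      destruct (ccs_bisim_match HP HP0) as (P1 & HP1 & HbP);
      destruct (ccs_bisim_match HQ HQ0) as (Q1 & HQ1 & HbQ);
      exists (Par P1 Q1); (split; [apply Hlift; eauto using st_syn, st_synr|]);
      exists P0, P1, Q0, Q1; repeat split; auto using sc_sym, sc_refl.
Qed.

Lemma ccs_bisim_par P P' Q Q' :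
  ccs_bisim P P' -> ccs_bisim Q Q' -> ccs_bisim (Par P Q) (Par P' Q').
Proof.
  intros HP HQ; exists par_closure; split.
  - intros S S' H; split; [intros al T Hs; exact (par_closure_step H Hs)|].
    intros al T' Hs; destruct (par_closure_step (par_closure_sym H) Hs) as (T & ? & ?).
    exists T; split; auto using par_closure_sym.
  - exists P, P', Q, Q'; repeat split; auto using sc_refl.
Qed.

(* Part (1): the quotient by bisimilarity lies in R_(X,g) and receives an arrow
   from every object of the coslice. *)
Lemma ccs_R_conditions : R_conditions (ccs_coalg C) R_g.
Proof.
  split.
  - intro h; exists (quotient_obj _ (ccs_coalg C)); split; [|apply arrow_to_quotient].
    intros x x' y y' Hx Hy; apply class_of_eq in Hx, Hy; apply class_of_eq, ccs_bisim_par; auto.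
  - intros x x' y y' Hx Hy; simpl in *; congruence.
Qed.

Section DeltaRespects.
Variables (Y : Type) (h : proc -> Y).
Hypothesis h_par : forall x x' y y', h x = h x' -> h y = h y' -> h (Par x y) = h (Par x' y').

Lemma delta_sync_image_incl (p1 p2 q1 q2 : Fo (TF prefix) proc) z :
  Fm (TF prefix) h p1 = Fm (TF prefix) h q1 -> Fm (TF prefix) h p2 = Fm (TF prefix) h q2 ->
  Fm BF h (delta (inr (p1, p2))) z -> Fm BF h (delta (inr (q1, q2))) z.
Proof.
  intros E1 E2 (w & (x & y & a & -> & Hsyn) & <-).
  destruct Hsyn as [[Hx Hy]|[Hx Hy]];
    destruct (TF_map_transfer E1 Hx) as (x' & Hx' & Ex);
    destruct (TF_map_transfer E2 Hy) as (y' & Hy' & Ey);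
    exists (Par x' y'); (split; [exists x', y', a; auto | apply h_par; auto]).
Qed.

Lemma delta_respects (z1 z2 : Fo (compF FF (TF prefix)) proc) :
  Fm (compF FF (TF prefix)) h z1 = Fm (compF FF (TF prefix)) h z2 ->
  Fm BF h (delta z1) = Fm BF h (delta z2).
Proof.
  destruct z1 as [p1|[p1 p2]], z2 as [q1|[q1 q2]]; simpl; intro E; try discriminate.
  - injection E as E; apply functional_extensionality; intro y; exact (equal_f E (tau C, y)).
  - injection E as E1 E2; apply functional_extensionality; intro z; apply propositional_extensionality.
    split; apply delta_sync_image_incl; auto.
Qed.
End DeltaRespects.

Lemma lambda_image (Y : Type) (h : proc -> Y) x :
  Fm (compF (TF prefix) FF) h (lambda x) =
  fun p => (fst p = tau C /\ snd p = inl (h x)) \/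
           (exists a, fst p = inp a /\ snd p = inr (h x, h (Sum [(out a, nil0)]))) \/
           (exists a, fst p = out a /\ snd p = inr (h x, h (Sum [(inp a, nil0)]))).
Proof.
  apply functional_extensionality; intros [l w]; apply propositional_extensionality; simpl; split.
  - intros (w0 & Hw & <-); unfold lambda in Hw; simpl in Hw.
    destruct Hw as [[-> ->]|[(a & -> & ->)|(a & -> & ->)]]; simpl; eauto 6.
  - intros [[-> ->]|[(a & -> & ->)|(a & -> & ->)]];
      [exists (inl x) | exists (inr (x, Sum [(out a, nil0)])) | exists (inr (x, Sum [(inp a, nil0)]))];
      unfold lambda; simpl; eauto 7.
Qed.

End CCSTheory.

Theorem proposition5 (C : Type)
  (C_countable : exists e : C -> nat, forall a b : C, e a = e b -> a = b) :
  (* (1) R_(X,g) satisfies conditions (1) and (2) *)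
  R_conditions (ccs_coalg C) R_g /\
  (* (2) id_{FX} : F-bar -> F o Id-bar, for (X,g) and R_(X,g) *)
  is_invariant (ccs_coalg C) R_g FF (compF FF IdF) (fun z => z) /\
  (* (3) delta : F o T-bar -> B-bar, for (X,g) and R_(X,g) *)
  is_invariant (ccs_coalg C) R_g (compF FF (TF (prefix C))) BF delta /\
  (* (4) lambda : Id-bar -> T o F-bar, for (X,f) and R_(X,f) *)
  is_invariant (ccs_dialg C) R_f IdF (compF (TF (prefix C)) FF) lambda /\
  (* (5) mu : T o B-bar -> T-bar, for (X,f) and R_(X,f) *)
  is_invariant (ccs_dialg C) R_f (compF (TF (prefix C)) BF) (TF (prefix C)) mu.
Proof.
  split; [apply ccs_R_conditions|].
  split; [intros z1 z2 h _ E; exact E|].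
  split; [intros z1 z2 h h_par; apply delta_respects, h_par|].
  split; [intros x1 x2 h _ E; simpl in E; rewrite !lambda_image, E; reflexivity|].
  intros q1 q2 h _ E.
  change (Fm (TF (prefix C)) (omap h) (flatten_T q1) = Fm (TF (prefix C)) (omap h) (flatten_T q2)).
  rewrite !flatten_T_natural, E; reflexivity.
Qed.
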